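(* Let $a$ be a weak composition of length $n$. Then $$\mathfrak L_a = \sum_{w \textrm{ is $a$-flag compatible}} x^{\mathrm{comp}(w)}.$$
   Context: $\mathfrak L_a$ is the fundamental particle (Searles): the generating function $\sum x^{\mathrm{wt}(T)}$ over fillings $T$ of the diagram of $a$ (row $i$ has $a_i$ left-justified boxes) such that rows weakly decrease left to right, the first entry of each row $i$ equals $i$, and whenever $i<j$ every entry of row $i$ is strictly smaller than every entry of row $j$. For a word $b=b_1\cdots b_p$, a word $w$ is $b$-compatible if $1\le w_1\le\cdots\le w_p\le n$, $w_k<w_{k+1}$ whenever $b_k<b_{k+1}$, and $w_k\le b_k$; $\mathrm{comp}(w)$ counts occurrences of each $i$ in $w$. Let $S=\{p_1,\ldots,p_k\}$ be the set of partial sums of the entries of $a$ (duplicates, arising from zero entries, removed). A compatible sequence $w$ for the word formed by writing $a_i$ copies of $i$ consecutively for $i=1,\ldots,n$ is $a$-flag compatible if for each $p_i\in S$ the letter in position $p_i$ of $w$ equals the row index of the $i$th nonzero entry of $a$. *)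

(* Defs.v *)
From mathcomp Require Import all_boot all_order all_algebra.
From mathcomp Require Import mpoly.

Set Implicit Arguments.
Unset Strict Implicit.
Unset Printing Implicit Defensive.

Import GRing.Theory.

(* Rows of a diagram, entries of a filling, letters of a word and variables   *)
(* are all elements of 'I_n, so the label i of [n] = {1, ..., n} is the       *)
(* ordinal of value i - 1.                                                    *)

Definition box (n : nat) (a : n.-tuple nat) : finType :=
  {i : 'I_n & 'I_(tnth a i)}.

(* Taking entries in [n] loses nothing: row i starts with i and weakly        *)
(* decreases, so all entries of a particle filling are at most n.             *)
Definition filling (n : nat) (a : n.-tuple nat) : finType :=
  {ffun box a -> 'I_n}.

Definition entry (n : nat) (a : n.-tuple nat) (T : filling a)
    (i : 'I_n) (j : 'I_(tnth a i)) : 'I_n :=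
  T (Tagged (fun i => 'I_(tnth a i)) j).

Definition particle_filling (n : nat) (a : n.-tuple nat) (T : filling a) :
    bool :=
  [&& [forall i : 'I_n, forall j : 'I_(tnth a i), forall k : 'I_(tnth a i),
         (j <= k)%N ==> (entry T k <= entry T j)%N],
      [forall i : 'I_n, forall j : 'I_(tnth a i),
         (j == 0%N :> nat) ==> (entry T j == i)]
    & [forall i : 'I_n, forall j : 'I_n, (i < j)%N ==>
         [forall k : 'I_(tnth a i), forall l : 'I_(tnth a j),
            (entry T k < entry T l)%N]]].

Definition wt (n : nat) (a : n.-tuple nat) (T : filling a) : 'X_{1..n} :=
  [multinom #|[set c : box a | T c == i]| | i < n].

Definition fundamental_particle (n : nat) (a : n.-tuple nat) :
    {mpoly int[n]} :=
  (\sum_(T : filling a | particle_filling T) 'X_[wt T])%R.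

(* The bounds 1 <= w_1 and w_p <= n are carried by the type of the letters.   *)
Definition compatible (n : nat) (b : seq 'I_n) (w : (size b).-tuple 'I_n) :
    bool :=
  [&& sorted leq (map val w),
      [forall k : 'I_(size b), forall l : 'I_(size b),
         (l == k.+1 :> nat) ==>
         (tnth (in_tuple b) k < tnth (in_tuple b) l)%N ==>
         (tnth w k < tnth w l)%N]
    & [forall k : 'I_(size b), (tnth w k <= tnth (in_tuple b) k)%N]].

Definition word_comp (n : nat) (w : seq 'I_n) : 'X_{1..n} :=
  [multinom count_mem i w | i < n].

Definition row_word (n : nat) (a : n.-tuple nat) : seq 'I_n :=
  flatten [seq nseq (tnth a i) i | i <- enum 'I_n].

(* p_1 < ... < p_k. A null partial sum (from leading zero entries) is not a   *)
(* position of a word and is dropped, so that k is the number of nonzero      *)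
(* entries of a.                                                              *)
Definition partial_sums (n : nat) (a : n.-tuple nat) : seq nat :=
  [seq p <- undup [seq sumn (take i a) | i <- iota 1 n] | p != 0%N].

Definition nonzero_rows (n : nat) (a : n.-tuple nat) : seq 'I_n :=
  [seq i <- enum 'I_n | tnth a i != 0%N].

(* Positions are counted from 1 in partial_sums and from 0 by onth. Both      *)
(* lookups are always in range.                                               *)
Definition flag_compatible (n : nat) (a : n.-tuple nat)
    (w : (size (row_word a)).-tuple 'I_n) : bool :=
  compatible w &&
  [forall i : 'I_(size (partial_sums a)),
     onth w (nth 0%N (partial_sums a) i).-1 == onth (nonzero_rows a) i].

Arguments flag_compatible {n} a w.

(* Main.v *)
(* Reading every row of the diagram from right to left, and the rows by
   increasing index, turns fillings into words. The flag condition fixes the last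
   letter of each nonempty row to be the row index. Given this, the ascents
   forced at the ends of rows amount to the strict inequalities between all
   entries of different rows, and the bound w_k <= b_k is the bound of a weakly
   decreasing row by its first entry. *)

Require Import Defs.
From mathcomp Require Import all_boot all_order all_algebra.
From mathcomp Require Import mpoly.
From mathcomp Require Import zify.

Set Implicit Arguments.
Unset Strict Implicit.
Unset Printing Implicit Defensive.

Lemma leq_sumn_take (s : seq nat) : {homo (fun i => sumn (take i s)) : i j / i <= j}.
Proof.
move=> i j le_ij; rewrite -(subnKC le_ij) takeD sumn_cat; exact: leq_addr.
Qed.

Notation Box := (Tagged (fun i => 'I_(tnth _ i))).

Section RowWord.

Variables (n : nat) (a : n.-tuple nat).

Notation m := (size (row_word a)).

Lemma sumn_takeS (i : 'I_n) :
  sumn (take i.+1 a) = sumn (take i a) + tnth a i.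
Proof. by rewrite (take_nth 0) ?size_tuple // sumn_rcons (tnth_nth 0). Qed.

Lemma shape_rows : shape [seq nseq (tnth a i) i | i <- enum 'I_n] = a.
Proof.
rewrite /shape -map_comp -[RHS](map_tnth_enum a).
by apply: eq_map => i /=; rewrite size_nseq.
Qed.

Lemma size_row_word : m = sumn a.
Proof. by rewrite size_flatten shape_rows. Qed.

Lemma nth_row_word (x0 i : 'I_n) c :
  c < tnth a i -> nth x0 (row_word a) (flatten_index a i c) = i.
Proof.
rewrite (tnth_nth 0) => lt_c.
rewrite nth_flatten shape_rows flatten_indexKl // flatten_indexKr //.
rewrite (nth_map i) ?size_enum_ord // nth_ord_enum.
by rewrite nth_nseq (tnth_nth 0) lt_c.
Qed.

Lemma box_pos_subproof (b : box a) :
  flatten_index a (tag b) (rev_ord (tagged b)) < m.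
Proof. by rewrite size_row_word flatten_indexP // -tnth_nth ltn_ord. Qed.

(* rev_ord: within a row, the leftmost box comes last. *)
Definition box_pos (b : box a) : 'I_m := Ordinal (box_pos_subproof b).

Lemma tnth_row_word (b : box a) :
  tnth (in_tuple (row_word a)) (box_pos b) = tag b.
Proof. by rewrite (tnth_nth (tag b)) nth_row_word. Qed.

(** The letters of row [i] occupy the block of positions from [sumn (take i a)] up to, but
    excluding, [sumn (take i.+1 a)], and these blocks follow one another. *)
Lemma box_pos_lt (b c : box a) : tag b < tag c -> box_pos b < box_pos c.
Proof.
move=> lt_bc; have := leq_sumn_take a lt_bc; rewrite sumn_takeS /= => le_s.
apply: leq_trans (leq_trans le_s (leq_addr _ _)).
by rewrite ltn_add2l; apply: (ltn_ord (rev_ord (tagged b))).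
Qed.

Lemma box_pos_le_tag (b c : box a) : box_pos b <= box_pos c -> tag b <= tag c.
Proof. by apply: contraTT; rewrite -!ltnNge; apply: box_pos_lt. Qed.

Lemma box_pos_row (i : 'I_n) (j k : 'I_(tnth a i)) :
  (box_pos (Box j) <= box_pos (Box k)) = (k <= j).
Proof.
by rewrite leq_add2l /=; move: (ltn_ord j) (ltn_ord k); lia.
Qed.

Lemma box_pos_inj : injective box_pos.
Proof.
move=> b c eq_pos; have /val_inj : tag b = tag c :> nat.
  by apply/anti_leq; rewrite !box_pos_le_tag ?eq_pos.
case: b c eq_pos => i j [i' j'] eq_pos /= eq_ii'.
(* Eliminating the equality of rows gives both column indices the same type, so they can be
   compared. *)
case: _ / eq_ii' in j' eq_pos *; congr Tagged; apply/val_inj/anti_leq.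
by rewrite -!box_pos_row eq_pos leqnn.
Qed.

(** Injectivity suffices, since boxes and positions both number [sumn a]. *)
Lemma box_pos_bij : bijective box_pos.
Proof.
apply: (inj_card_bij box_pos_inj).
rewrite card_ord card_tagged size_row_word -[in sumn _](map_tnth_enum a).
by rewrite (eq_map (fun i => card_ord (tnth a i))).
Qed.

Lemma box_of_pos (k : 'I_m) : exists b, k = box_pos b.
Proof. by case: box_pos_bij => g _ gK; exists (g k); rewrite gK. Qed.

(** Both lists are strictly increasing, so it is enough that they have the same members. This aligns
    the [k]th partial sum with the [k]th nonempty row. *)
Lemma partial_sumsE :
  partial_sums a = [seq sumn (take i.+1 a) | i : 'I_n <- nonzero_rows a].
Proof.
have take_mono : sorted leq [seq sumn (take i a) | i <- iota 1 n].
  apply: homo_sorted (iota_sorted 1 n); exact: leq_sumn_take.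
apply: (irr_sorted_eq ltn_trans ltnn).
- apply: sorted_filter; first exact: ltn_trans.
  by rewrite ltn_sorted_uniq_leq undup_uniq undup_sorted //; apply: leq_trans.
- rewrite sorted_map /nonzero_rows.
  have : sorted (fun i j : 'I_n => i < j) (nonzero_rows a).
    apply: sorted_filter; first by move=> i j k; apply: ltn_trans.
    by have := iota_ltn_sorted 0 n; rewrite -val_enum_ord sorted_map.
  (* Strictness comes from the later of two rows being nonempty, hence the restriction to nonzero
     entries. *)
  apply: (@sub_in_sorted _ [pred i | tnth a i != 0]); last exact: filter_all.
  move=> i j _; rewrite inE -lt0n => aj_gt0 lt_ij /=.
  rewrite (sumn_takeS j); apply: leq_trans (_ : sumn (take j a) < _).
    by rewrite ltnS leq_sumn_take.
  by rewrite -[X in X < _]addn0 ltn_add2l.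
move=> p; rewrite mem_filter mem_undup; apply/andP/mapP=> [[p_neq0]|[i nz_i ->]].
  case/mapP=> i; rewrite mem_iota add1n ltnS => /andP[_].
  (* A zero entry leaves the sum unchanged, so one descends to the last nonempty row among the first
     [i]; it exists because [p] is nonzero. *)
  elim: i => [_|i IHi lt_in] def_p.
    by rewrite def_p take0 in p_neq0.
  have [ai0|ai_neq0] := eqVneq (tnth a (Ordinal lt_in)) 0; last first.
    by exists (Ordinal lt_in); rewrite // mem_filter ai_neq0 mem_enum.
  apply: IHi; first exact: ltnW.
  by rewrite def_p (sumn_takeS (Ordinal lt_in)) ai0 addn0.
move: nz_i; rewrite mem_filter => /andP[ai_neq0 _]; split.
  by rewrite sumn_takeS addn_eq0 (negPf ai_neq0) andbF.
by apply: map_f; rewrite mem_iota add1n; apply: ltn_ord.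
Qed.

(** The leftmost box is read last in its row, so it sits where the flag condition looks; the
    predecessor converts a position counted from 1 to one counted from 0. *)
Lemma box_pos_first (i : 'I_n) (j : 'I_(tnth a i)) :
  j = 0 :> nat -> box_pos (Box j) = (sumn (take i.+1 a)).-1 :> nat.
Proof.
move=> j0; rewrite sumn_takeS /= j0 /flatten_index.
by move: (ltn_ord j); lia.
Qed.

End RowWord.

Section Filling.

Variables (n : nat) (a : n.-tuple nat).

Notation m := (size (row_word a)).

(** Going from words to fillings avoids naming an inverse of [box_pos]: an entry is directly a
    letter. *)
Definition word_filling (w : m.-tuple 'I_n) : filling a :=
  [ffun b => tnth w (box_pos b)].

Lemma word_filling_bij : bijective word_filling.
Proof.
have [g gK posK] := box_pos_bij a.
exists (fun T : {ffun box a -> 'I_n} => [tuple T (g k) | k < m]) => [w|T].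
  by apply: eq_from_tnth => k; rewrite tnth_mktuple ffunE posK.
by apply/ffunP=> b; rewrite ffunE tnth_mktuple gK.
Qed.

Lemma wt_word_filling (w : m.-tuple 'I_n) : wt (word_filling w) = word_comp w.
Proof.
apply/mnmP=> i; rewrite !mnmE -[in RHS](map_tnth_enum w) count_map.
rewrite -sum1_count big_enum_cond sum1dep_card.
rewrite -(on_card_preimset (onW_bij _ (box_pos_bij a))).
by apply: eq_card => b; rewrite !inE ffunE.
Qed.

(** Through [partial_sumsE] and [box_pos_first], the condition indexed by partial sums becomes the
    first-column condition on particle fillings. *)
Lemma flag_compatibleE (w : m.-tuple 'I_n) :
  flag_compatible a w =
  compatible w &&
  [forall i : 'I_n, forall j : 'I_(tnth a i),
     (j == 0 :> nat) ==> (entry (word_filling w) j == i)].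
Proof.
have onth_w k : onth w (k : 'I_m) = Some (tnth w k).
  exact/tnth_onth.
have nth_ps k i : k < size (nonzero_rows a) ->
    nth 0 (partial_sums a) k = sumn (take (nth i (nonzero_rows a) k).+1 a).
  by move=> lt_k; rewrite partial_sumsE (nth_map i).
congr (_ && _); apply/forallP/forallP => [flag_w i|first_w k].
  apply/forallP => j; apply/implyP => /eqP j0.
  have nz_i : i \in nonzero_rows a.
    by rewrite mem_filter mem_enum -lt0n (leq_ltn_trans _ (ltn_ord j)).
  have lt_k : index i (nonzero_rows a) < size (partial_sums a).
    by rewrite partial_sumsE size_map index_mem.
  have /= := flag_w (Ordinal lt_k).
  rewrite (nth_ps _ i) ?index_mem // nth_index // -(box_pos_first j0) onth_w.
  rewrite onthE (nth_map i) ?index_mem // nth_index //.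
  by rewrite /entry ffunE => /eqP[->].
have lt_k : k < size (nonzero_rows a).
  by rewrite -(size_map (fun i : 'I_n => sumn (take i.+1 a))) -partial_sumsE.
case def_i: (onth _ k) (onthTE (nonzero_rows a) k) => [i|]; last by rewrite lt_k.
move=> _; have nth_i := onth_nth i _ _ _ def_i.
have: i \in nonzero_rows a by rewrite -nth_i mem_nth.
rewrite mem_filter -lt0n => /andP[ai_gt0 _].
rewrite (nth_ps _ i) // nth_i.
rewrite -(@box_pos_first _ _ i (Ordinal ai_gt0)) // onth_w.
have /forallP/(_ (Ordinal ai_gt0)) := first_w i.
by rewrite /entry ffunE => /eqP ->.
Qed.

Lemma particle_word_filling (w : m.-tuple 'I_n) :
  particle_filling (word_filling w) = flag_compatible a w.
Proof.
have b_tag b : tnth (in_tuple (row_word a)) (box_pos b) = tag b := tnth_row_word b.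
have nth_w (k : 'I_m) : nth 0 (map val w) k = tnth w k.
  by rewrite (nth_map (tnth w k)) ?size_tuple // -tnth_nth.
rewrite flag_compatibleE; apply/and3P/andP => [[rowT firstT strictT]|[cw firstT]].
  have row_le i (j k : 'I_(tnth a i)) : j <= k ->
      tnth w (box_pos (Box k)) <= tnth w (box_pos (Box j)).
    move=> le_jk; have /forallP/(_ i)/forallP/(_ j)/forallP/(_ k) := rowT.
    by rewrite le_jk /entry !ffunE.
  have row_lt (b c : box a) : tag b < tag c -> tnth w (box_pos b) < tnth w (box_pos c).
    case: b c => i j [i' j'] /= lt_ii'.
    have /forallP/(_ i)/forallP/(_ i')/implyP/(_ lt_ii') := strictT.
    by move=> /forallP/(_ j)/forallP/(_ j'); rewrite /entry !ffunE.
  split=> //; apply/and3P; split.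
  (* Two consecutive positions lie either in one row, where entries weakly decrease to the right, or
     in two rows, where strictness applies. *)
  - apply/(sortedP 0) => k; rewrite size_map size_tuple => lt_k.
    have [b def_b] := box_of_pos (Ordinal (ltnW lt_k)).
    have [c def_c] := box_of_pos (Ordinal lt_k).
    rewrite (nth_w (Ordinal (ltnW lt_k))) (nth_w (Ordinal lt_k)) def_b def_c.
    have lt_bc : box_pos b < box_pos c by rewrite -def_b -def_c /=.
    case: b c {def_b def_c} lt_bc => i j [i' j'] lt_bc.
    have := box_pos_le_tag (ltnW lt_bc); rewrite leq_eqVlt.
    case/predU1P=> [/val_inj /= eq_ii' | /row_lt/ltnW //].
    case: _ / eq_ii' in j' lt_bc *; apply: row_le.
    by rewrite -box_pos_row ltnW.
  - apply/forallP=> k; apply/forallP=> l; apply/implyP=> _; apply/implyP.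
    have [b ->] := box_of_pos k; have [c ->] := box_of_pos l.
    by rewrite !b_tag; apply: row_lt.
  - apply/forallP=> k; have [[i j] ->] := box_of_pos k; rewrite b_tag.
    have ai_gt0 : 0 < tnth a i by apply: leq_ltn_trans (ltn_ord j).
    apply: leq_trans (row_le _ (Ordinal ai_gt0) j _) _ => //.
    have /forallP/(_ i)/forallP/(_ (Ordinal ai_gt0)) := firstT.
    by rewrite /entry ffunE => /eqP ->.
have /and3P[sorted_w break_w _] := cw.
have w_le (k l : 'I_m) : k <= l -> tnth w k <= tnth w l.
  move=> le_kl; have := sorted_leq_nth leq_trans leqnn 0 sorted_w (val k) (val l).
  rewrite !inE size_map size_tuple => /(_ (ltn_ord k) (ltn_ord l) le_kl).
  by rewrite !nth_w.
split=> //.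
  apply/forallP=> i; apply/forallP=> j; apply/forallP=> k; apply/implyP=> le_jk.
  by rewrite /entry !ffunE w_le // box_pos_row.
apply/forallP=> i; apply/forallP=> i'; apply/implyP=> lt_ii'.
apply/forallP=> j; apply/forallP=> j'; rewrite /entry !ffunE.
have ai_gt0 : 0 < tnth a i by apply: leq_ltn_trans (ltn_ord j).
(* [b0] ends the block of row [i], so the ascent forced just after it separates row [i] from all
   later rows. *)
pose b0 : box a := Box (Ordinal ai_gt0).
have lt_pos : box_pos b0 < box_pos (Box j') by apply: box_pos_lt.
have lt_next : (box_pos b0).+1 < m := leq_ltn_trans lt_pos (ltn_ord _).
have [c def_c] := box_of_pos (Ordinal lt_next).
(* No box of row [i] is read after its leftmost one, so the box [c] read just after [b0] belongs to
   a later row. *)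
have lt_ic : i < tag c.
  have lt_b0c : box_pos b0 < box_pos c by rewrite -def_c /=.
  case: c {def_c} lt_b0c => i1 j1 lt_b0c.
  have := box_pos_le_tag (ltnW lt_b0c); rewrite leq_eqVlt.
  case/predU1P=> [/val_inj /= eq_i1 | //].
  case: _ / eq_i1 in j1 lt_b0c *.
  by move: lt_b0c; rewrite ltnNge box_pos_row.
(* The letters at [Box j], [b0], [c], [Box j'] are compared in this order: weakly, strictly,
   weakly. *)
apply: leq_ltn_trans (w_le _ (box_pos b0) _) _; first by rewrite box_pos_row.
apply: leq_trans (w_le (box_pos c) _ _); last by rewrite -def_c.
have /forallP/(_ (box_pos b0))/forallP/(_ (box_pos c)) := break_w.
by rewrite !b_tag lt_ic -def_c eqxx.
Qed.

End Filling.

Theorem mainTheorem12 (n : nat) (a : n.-tuple nat) :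
  fundamental_particle a =
  (\sum_(w : (size (row_word a)).-tuple 'I_n | flag_compatible a w)
      'X_[word_comp w])%R.
Proof.
rewrite /fundamental_particle (reindex _ (onW_bij _ (word_filling_bij a))).
by apply: eq_big => [w|w _]; rewrite ?particle_word_filling ?wt_word_filling.
Qed.
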